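(* For $\sigma>0$ and $\theta\in[0,2\pi)$, let $\widetilde T_{\sigma,\theta}:=\frac{1}{\sqrt{1+\sigma^2}}\,T_{\sigma,\theta}$, where $T_{\sigma,\theta}$ is the $3$-Brownian shift. Then $\widetilde T_{\sigma,\theta}\in C_{00}$.
   Context: $H^2(\mathbb D)$ and $H^2(\mathbb D^2)$ are the Hardy spaces of the unit disk and bidisk (power series with square-summable coefficients, $\ell^2$ coefficient norm). The $3$-Brownian shift $T_{\sigma,\theta}$ acts on $H^2(\mathbb D^2)\oplus H^2(\mathbb D)\oplus\mathbb C$ by $T_{\sigma,\theta}(F,f,\alpha)=(z_1F+\sigma f_{z_2},\ zf+\sigma\alpha,\ e^{i\theta}\alpha)$, where $f_{z_2}(z_1,z_2):=f(z_2)$. A contraction $T$ on a Hilbert space belongs to the class $C_{00}$ if both $T^m\to0$ and $T^{*m}\to0$ in the strong operator topology as $m\to\infty$. *)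

(* Defs.v *)
From HB Require Import structures.
From mathcomp Require Import all_boot all_order all_algebra.
From mathcomp Require Import sesquilinear complex.
From mathcomp Require Import all_classical all_reals all_analysis.
From mathcomp Require Import ring lra.

Set Implicit Arguments.
Unset Strict Implicit.
Unset Printing Implicit Defensive.

Import Order.TTheory GRing.Theory Num.Theory.
Import numFieldNormedType.Exports.
Import Normc.

Local Open Scope classical_set_scope.
Local Open Scope ring_scope.
Local Open Scope complex_scope.

Section Sums.
Variables (R : realType) (I : choiceType).
Implicit Types (f g : I -> R) (u v : I -> R[i]).

Definition rsummable f : bool :=
  (\esum_(i in [set: I]) `|f i|%:E < +oo)%E.

(* Unordered sum as positive part minus negative part; [fine] makes it
   meaningful only when [rsummable f] holds, and likewise for [csum]. *)
Definition rsum f : R :=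
  fine (\esum_(i in [set: I]) (Num.max (f i) 0)%:E) -
  fine (\esum_(i in [set: I]) (Num.max (- f i) 0)%:E).

Definition csummable u : bool := rsummable (fun i => normc (u i)).

Definition csum u : R[i] :=
  Complex (rsum (fun i => complex.Re (u i))) (rsum (fun i => complex.Im (u i))).

Lemma rsummable_le f g : (forall i, `|f i| <= `|g i|) ->
  rsummable g -> rsummable f.
Proof.
by move=> fg; apply: le_lt_trans; apply: le_esum => i _; rewrite lee_fin.
Qed.

Lemma rsummableD f g : rsummable f -> rsummable g ->
  rsummable (fun i => f i + g i).
Proof.
move=> hf hg; have := lte_add_pinfty hf hg; rewrite -esumD//.
apply: le_lt_trans; apply: le_esum => i _.
by rewrite -EFinD lee_fin ler_normD.
Qed.

Lemma esum_fin f : (forall i, 0 <= f i) -> rsummable f ->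
  (\esum_(i in [set: I]) (f i)%:E)%E \is a fin_num.
Proof.
move=> f0 hf; rewrite ge0_fin_numE; last by apply: esum_ge0 => i _; rewrite lee_fin.
by apply: le_lt_trans hf; apply: le_esum => i _; rewrite lee_fin ler_norm.
Qed.

Lemma rsum_ge0E f : (forall i, 0 <= f i) ->
  rsum f = fine (\esum_(i in [set: I]) (f i)%:E).
Proof.
move=> f0; rewrite /rsum [X in _ - fine X]esum1 ?subr0.
  by congr fine; apply: eq_esum => i _; rewrite max_l.
by move=> i _; rewrite max_r// oppr_le0.
Qed.

Lemma rsumB_ge0 f g h : (forall i, 0 <= f i) -> (forall i, 0 <= g i) ->
  rsummable f -> rsummable g -> (forall i, h i = f i - g i) ->
  rsum h = rsum f - rsum g.
Proof.
move=> f0 g0 sf sg hE; rewrite (rsum_ge0E f0) (rsum_ge0E g0) /rsum.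
have sh : rsummable h.
  apply: rsummable_le (rsummableD sf sg) => i.
  rewrite hE (ger0_norm (addr_ge0 (f0 i) (g0 i))).
  by rewrite -{2}(ger0_norm (f0 i)) -{2}(ger0_norm (g0 i)) ler_normB.
have sp : rsummable (fun i => Num.max (h i) 0).
  apply: rsummable_le sh => i.
  by case: (leP (h i) 0) => hi; rewrite ?normr0.
have sm : rsummable (fun i => Num.max (- h i) 0).
  apply: rsummable_le sh => i.
  by case: (leP (- h i) 0) => hi; rewrite ?normr0 ?normrN.
have p0 i : 0 <= Num.max (h i) 0 by rewrite le_max lexx orbT.
have m0 i : 0 <= Num.max (- h i) 0 by rewrite le_max lexx orbT.
have fp := esum_fin p0 sp; have fm := esum_fin m0 sm.
have ff := esum_fin f0 sf; have fg := esum_fin g0 sg.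
apply/eqP; rewrite subr_eq addrAC eq_sym subr_eq eq_sym.
rewrite -!fineD//; apply/eqP; congr fine.
rewrite -!esumD; try by move=> i _; rewrite lee_fin.
apply: eq_esum => i _; rewrite -!EFinD; congr EFin.
rewrite hE; case: (leP (f i - g i) 0) => h1; case: (leP (- (f i - g i)) 0) => h2; lra.
Qed.

Lemma rsumD f g : rsummable f -> rsummable g ->
  rsum (fun i => f i + g i) = rsum f + rsum g.
Proof.
pose p (h : I -> R) i := Num.max (h i) 0.
pose m (h : I -> R) i := Num.max (- h i) 0.
have p0 h i : 0 <= p h i by rewrite le_max lexx orbT.
have m0 h i : 0 <= m h i by rewrite le_max lexx orbT.
have pm h i : h i = p h i - m h i.
  by rewrite /p /m; case: (leP (h i) 0) => h1; case: (leP (- h i) 0) => h2; lra.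
have sp h : rsummable h -> rsummable (p h).
  by apply: rsummable_le => i; rewrite /p; case: (leP (h i) 0); rewrite ?normr0.
have sm h : rsummable h -> rsummable (m h).
  by apply: rsummable_le => i; rewrite /m; case: (leP (- h i) 0);
    rewrite ?normr0 ?normrN.
move=> sf sg.
have add h k : (forall i, 0 <= h i) -> (forall i, 0 <= k i) ->
    rsummable h -> rsummable k ->
    rsum (fun i => h i + k i) = rsum h + rsum k.
  move=> h0 k0 sh sk; rewrite !rsum_ge0E//; last by move=> i; exact: addr_ge0.
  rewrite -fineD ?esum_fin// -esumD// => i _; exact: h0 || exact: k0.
rewrite (@rsumB_ge0 (fun i => p f i + p g i) (fun i => m f i + m g i)).
- rewrite (add _ _ (p0 f) (p0 g) (sp _ sf) (sp _ sg)).
  rewrite (add _ _ (m0 f) (m0 g) (sm _ sf) (sm _ sg)).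
  rewrite (rsumB_ge0 (p0 f) (m0 f) (sp _ sf) (sm _ sf) (pm f)).
  rewrite (rsumB_ge0 (p0 g) (m0 g) (sp _ sg) (sm _ sg) (pm g)).
  by rewrite opprD addrACA.
- by move=> i; rewrite addr_ge0.
- by move=> i; rewrite addr_ge0.
- by apply: rsummableD; exact: sp.
- by apply: rsummableD; exact: sm.
- by move=> i; rewrite {1}(pm f i) {1}(pm g i) opprD addrACA.
Qed.

Lemma rsumN f : rsum (fun i => - f i) = - rsum f.
Proof.
rewrite /rsum opprB; congr (fine _ - fine _).
by apply: eq_esum => i _; rewrite opprK.
Qed.

Lemma eq_rsum f g : f =1 g -> rsum f = rsum g.
Proof. by move=> /funext ->. Qed.

Lemma esumZ a f : 0 <= a -> (forall i, 0 <= f i) ->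
  (\esum_(i in [set: I]) (a * f i)%:E = a%:E * \esum_(i in [set: I]) (f i)%:E)%E.
Proof.
have leZ b g : 0 <= b -> (forall i, 0 <= g i) ->
  (\esum_(i in [set: I]) (b * g i)%:E <= b%:E * \esum_(i in [set: I]) (g i)%:E)%E.
  move=> b0 g0; apply: ge_ereal_sup => _ [X [finX _]] <-.
  under eq_fsbigr do rewrite EFinM.
  rewrite -ge0_mule_fsumr; last by move=> i; rewrite lee_fin.
  by apply: lee_wpmul2l; [rewrite lee_fin|apply: esum_ge; exists X].
move=> a0 f0; have [->|an0] := eqVneq a 0.
  by rewrite mul0e esum1// => i _; rewrite mul0r.
apply/eqP; rewrite eq_le leZ//=.
have ai0 : 0 <= a^-1 by rewrite invr_ge0.
have := leZ a^-1 (fun i => a * f i) ai0 (fun i => mulr_ge0 a0 (f0 i)).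
under eq_esum do rewrite mulKf//.
move=> /(lee_wpmul2l (a0 : (0 <= a%:E)%E)).
by rewrite muleA -EFinM divff// mul1e.
Qed.

Lemma rsummableZ a f : rsummable f -> rsummable (fun i => a * f i).
Proof.
move=> sf; rewrite /rsummable; under eq_esum do rewrite normrM.
rewrite esumZ// lte_mul_pinfty// ?lee_fin//.
Qed.

Lemma rsumZ a f : rsummable f -> rsum (fun i => a * f i) = a * rsum f.
Proof.
have sp g : rsummable g -> rsummable (fun i => Num.max (g i) 0).
  by apply: rsummable_le => i; case: (leP (g i) 0); rewrite ?normr0.
have sN g : rsummable g -> rsummable (fun i => - g i).
  by apply: rsummable_le => i; rewrite normrN.
have max0 (x : R) : 0 <= Num.max x 0 by rewrite le_max lexx orbT.
have pos b g : 0 <= b -> rsummable g -> rsum (fun i => b * g i) = b * rsum g.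
  move=> b0 sg; rewrite /rsum mulrBr; congr (_ - _).
    rewrite -[b in RHS]/(fine b%:E) -fineM ?esum_fin ?sp// -esumZ//.
    by congr fine; apply: eq_esum => i _; rewrite -[in LHS](mulr0 b) maxr_pMr.
  rewrite -[b in RHS]/(fine b%:E) -fineM ?esum_fin ?sp ?sN// -esumZ//.
  by congr fine; apply: eq_esum => i _; rewrite -mulrN -[in LHS](mulr0 b) maxr_pMr.
move=> sf; case: (leP 0 a) => [a0|/ltW a0]; first exact: pos.
rewrite -[a]opprK mulNr -pos ?oppr_ge0// -rsumN.
by apply: eq_rsum => i; rewrite mulNr.
Qed.

Lemma normc_re_le (z : R[i]) : `|complex.Re z| <= `|normc z|.
Proof.
case: z => a b /=; rewrite (ger0_norm (sqrtr_ge0 _)) -sqrtr_sqr.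
by rewrite ler_wsqrtr// lerDl sqr_ge0.
Qed.

Lemma normc_im_le (z : R[i]) : `|complex.Im z| <= `|normc z|.
Proof.
case: z => a b /=; rewrite (ger0_norm (sqrtr_ge0 _)) -sqrtr_sqr.
by rewrite ler_wsqrtr// lerDr sqr_ge0.
Qed.

Lemma normc_ge0 (z : R[i]) : 0 <= normc z.
Proof. by case: z => a b; exact: sqrtr_ge0. Qed.

Lemma normcD_le (z w : R[i]) : normc (z + w) <= normc z + normc w.
Proof. by have := ler_normD z w; rewrite -rmorphD lecR. Qed.

Lemma csummable_re u : csummable u -> rsummable (fun i => complex.Re (u i)).
Proof. by apply: rsummable_le => i; exact: normc_re_le. Qed.

Lemma csummable_im u : csummable u -> rsummable (fun i => complex.Im (u i)).
Proof. by apply: rsummable_le => i; exact: normc_im_le. Qed.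

Lemma csummableD u v : csummable u -> csummable v ->
  csummable (fun i => u i + v i).
Proof.
move=> su sv; apply: rsummable_le (rsummableD su sv) => i.
by rewrite !ger0_norm ?normcD_le ?addr_ge0 ?normc_ge0.
Qed.

Lemma csummableZ a u : csummable u -> csummable (fun i => a * u i).
Proof.
move=> su; apply: rsummable_le (rsummableZ (normc a) su) => i.
by rewrite normcM.
Qed.

Lemma csumD u v : csummable u -> csummable v ->
  csum (fun i => u i + v i) = csum u + csum v.
Proof.
move=> su sv; apply/eqP; rewrite eq_complex /=; apply/andP; split; apply/eqP.
  rewrite -rsumD ?csummable_re//; apply: eq_rsum => i.
  by case: (u i) (v i) => [? ?] [].
rewrite -rsumD ?csummable_im//; apply: eq_rsum => i.
by case: (u i) (v i) => [? ?] [].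
Qed.

Lemma csumZ a u : csummable u -> csum (fun i => a * u i) = a * csum u.
Proof.
case: a => x y su; have sr := csummable_re su; have si := csummable_im su.
apply/eqP; rewrite eq_complex /=; apply/andP; split; apply/eqP.
  rewrite -mulNr -!rsumZ// -rsumD ?rsummableZ//; apply: eq_rsum => i.
  by case: (u i) => ? ? /=; rewrite mulNr.
rewrite -!rsumZ// -rsumD ?rsummableZ//; apply: eq_rsum => i.
by case: (u i) => ? ?.
Qed.

Lemma csum_conj u : csum (fun i => (u i)^*) = (csum u)^*.
Proof.
apply/eqP; rewrite eq_complex /=; apply/andP; split; apply/eqP.
  by apply: eq_rsum => i; case: (u i).
by rewrite -rsumN; apply: eq_rsum => i; case: (u i).
Qed.

End Sums.

Section Injection.
Variables (R : realType) (I J : choiceType) (e : I -> J).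
Hypothesis inj_e : injective e.

Lemma esum_inj (g : J -> \bar R) : (forall j, ~ range e j -> g j = 0%E) ->
  (\esum_(j in [set: J]) g j = \esum_(i in [set: I]) g (e i))%E.
Proof.
move=> g0; rewrite -(@esum_image _ _ _ setT e g); last by move=> x y _ _; exact: inj_e.
rewrite [RHS]esum_mkcond; apply: eq_esum => j _.
by case: ifPn => // /negP; rewrite inE => /g0.
Qed.

Lemma rsum_inj (g : J -> R) : (forall j, ~ range e j -> g j = 0) ->
  rsum g = rsum (fun i => g (e i)).
Proof.
by move=> g0; rewrite /rsum; congr (fine _ - fine _); rewrite esum_inj// => j /g0->;
  rewrite ?oppr0 max_r.
Qed.

Lemma rsummable_inj (g : J -> R) : (forall j, ~ range e j -> g j = 0) ->
  rsummable g = rsummable (fun i => g (e i)).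
Proof. by move=> g0; rewrite /rsummable esum_inj// => j /g0->; rewrite normr0. Qed.

Lemma csum_inj (g : J -> R[i]) : (forall j, ~ range e j -> g j = 0) ->
  csum g = csum (fun i => g (e i)).
Proof. by move=> g0; rewrite /csum !rsum_inj// => j /g0->. Qed.

End Injection.

Section SquareSummable.
Variables (R : realType) (I : choiceType).

Definition sqsummable : {pred I -> R[i]^o} :=
  fun a => (\esum_(i in [set: I]) (normc (a i) ^+ 2)%:E < +oo)%E.

Lemma sqsummableE (a : I -> R[i]) :
  (a \in sqsummable) = rsummable (fun i => normc (a i) ^+ 2).
Proof.
rewrite unfold_in /rsummable; congr (_ < _)%E.
by apply: eq_esum => i _; rewrite ger0_norm ?sqr_ge0.
Qed.

Lemma sqsummable_submod_closed : submod_closed sqsummable.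
Proof.
split=> [|c a b].
  rewrite sqsummableE /rsummable esum1 ?ltry// => i _.
  by rewrite normc0 expr0n normr0.
rewrite !sqsummableE => sa sb.
pose k := 2 * normc c ^+ 2.
apply: rsummable_le (rsummableD (rsummableZ k sa) (rsummableZ 2 sb)) => i.
rewrite ger0_norm ?sqr_ge0// ger0_norm; last first.
  by apply: addr_ge0; apply: mulr_ge0; rewrite ?sqr_ge0// mulr_ge0 ?sqr_ge0.
rewrite -[(c *: a + b) i]/(c * a i + b i).
have h := normcD_le (c * a i) (b i).
have h0 := normc_ge0 (c * a i + b i).
apply: (@le_trans _ _ ((normc (c * a i) + normc (b i)) ^+ 2)).
  by rewrite ler_pXn2r ?nnegrE// (le_trans h0).
rewrite normcM /k; have := sqr_ge0 (normc c * normc (a i) - normc (b i)).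
by rewrite !expr2; lra.
Qed.

HB.instance Definition _ :=
  GRing.isSubmodClosed.Build _ _ sqsummable sqsummable_submod_closed.

(* An element is the family of coefficients of a power series. *)
Record l2 := L2 { coef :> I -> R[i]^o ; _ : coef \in sqsummable }.

HB.instance Definition _ := [isSub for coef].
HB.instance Definition _ := [Choice of l2 by <:].
HB.instance Definition _ := [SubChoice_isSubLmodule of l2 by <:].

Lemma l2P (a : l2) : rsummable (fun i => normc (a i) ^+ 2).
Proof. by rewrite -sqsummableE; case: a. Qed.

Lemma l2_eqP (a b : l2) : (forall i, a i = b i) -> a = b.
Proof. by move=> ab; apply: val_inj; apply/funext. Qed.

Lemma l2D (a b : l2) i : (a + b) i = a i + b i. Proof. by []. Qed.
Lemma l2Z c (a : l2) i : (c *: a) i = c * a i. Proof. by []. Qed.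

Definition l2dot (a b : l2) : R[i]^o := csum (fun i => a i * (b i)^*).

Lemma normc_conj (z : R[i]) : normc z^* = normc z.
Proof. by case: z => x y /=; rewrite sqrrN. Qed.

Lemma csummable_mul (u v : I -> R[i]) :
  u \in sqsummable -> v \in sqsummable -> csummable (fun i => u i * v i).
Proof.
rewrite !sqsummableE => su sv; apply: rsummable_le (rsummableD su sv) => i.
rewrite !ger0_norm ?normc_ge0 ?addr_ge0 ?sqr_ge0// normcM.
have := sqr_ge0 (normc (u i) - normc (v i)); have := sqr_ge0 (normc (u i)).
by have := sqr_ge0 (normc (v i)); rewrite !expr2; lra.
Qed.

Lemma l2dot_summable (a b : l2) : csummable (fun i => a i * (b i)^*).
Proof.
apply: (@csummable_mul a (fun i => (b i)^*)); first by case: a.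
rewrite sqsummableE; apply: rsummable_le (l2P b) => i.
by rewrite normc_conj.
Qed.

Lemma l2dotC (a b : l2) : l2dot a b = (l2dot b a)^*.
Proof.
rewrite [RHS](esym (csum_conj _)); congr csum; apply/funext => i.
by rewrite -[LHS]/(a i * Num.conj (b i)) -[RHS]/(Num.conj (b i * Num.conj (a i)))
  rmorphM /= conjCK mulrC.
Qed.

Lemma l2dot_linl c (a a' b : l2) :
  l2dot (c *: a + a') b = c * l2dot a b + l2dot a' b.
Proof.
rewrite /l2dot -csumZ ?l2dot_summable// -csumD ?csummableZ ?l2dot_summable//.
by congr csum; apply/funext => i; rewrite l2D l2Z mulrDl mulrA.
Qed.

Lemma l2dot_herm (a b : l2) : l2dot a b = (-1) ^+ false * Num.conj (l2dot b a).
Proof. by rewrite expr0 mul1r; exact: l2dotC. Qed.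

Lemma l2dot_bilin : bilinear_for *%R (Num.conj \; *%R) l2dot.
Proof.
split=> [b|a] c u v; first exact: l2dot_linl.
rewrite l2dotC l2dot_linl [in RHS]l2dotC (l2dotC a v).
by rewrite -[(_ + _)^*]/(Num.conj _) rmorphD rmorphM.
Qed.

Lemma l2dotE (a : l2) : l2dot a a =
  (fine (\esum_(i in [set: I]) (normc (a i) ^+ 2)%:E))%:C.
Proof.
apply/eqP; rewrite eq_complex /=; apply/andP; split; apply/eqP.
  rewrite -rsum_ge0E => [|i]; last exact: sqr_ge0.
  apply: eq_rsum => i; case: (a i) => x y /=.
  by rewrite sqr_sqrtr ?addr_ge0 ?sqr_ge0// mulrN opprK.
rewrite (_ : (fun i => _) = (fun=> 0)).
  by rewrite rsum_ge0E// esum1.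
by apply/funext => i; case: (a i) => x y /=; rewrite mulrN mulrC addNr.
Qed.

Lemma l2dot_gt0 (a : l2) : a != 0 -> 0 < l2dot a a.
Proof.
move=> an0; rewrite l2dotE (ltcR 0).
have [i ain0] : exists i, a i != 0.
  apply: contrapT => /forallNP h; move/eqP: an0; apply; apply: l2_eqP => i.
  by apply/eqP/negPn/negP/h.
have ni : 0 < normc (a i) ^+ 2.
  rewrite exprn_gt0// lt_def normc_ge0 andbT.
  by apply: contra ain0 => /eqP/eq0_normc ->.
apply: lt_le_trans ni _.
have n0 j : 0 <= normc (a j) ^+ 2 by exact: sqr_ge0.
rewrite -lee_fin fineK ?esum_fin//; last exact: l2P.
apply: esum_ge; exists [set i]; first by split; [exact: finite_set1|].
by rewrite fsbig_set1.
Qed.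

HB.instance Definition _ := bilinear_isBilinear.Build R[i] l2 l2 R[i]^o
  (GRing.Scale.Law.clone _ _ *%R _)
  (GRing.Scale.Law.clone _ _ (Num.conj \; *%R) _) l2dot l2dot_bilin.
HB.instance Definition _ := isHermitianSesquilinear.Build R[i] l2 false
  Num.conj l2dot l2dot_herm.
HB.instance Definition _ := isDotProduct.Build R[i] l2 l2dot l2dot_gt0.

End SquareSummable.

Section InnerProduct.
Variables (R : realType) (V : lmodType R[i]) (dot : {dot V for Num.conj}).

Definition dotnorm (x : V) : R := Num.sqrt (complex.Re (dot x x)).

Definition contraction (T : V -> V) : Prop :=
  forall x, dotnorm (T x) <= dotnorm x.

Definition adjoint (T S : V -> V) : Prop :=
  forall x y, dot (T x) y = dot x (S y).

Definition powers_sot_cvg0 (T : V -> V) : Prop :=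
  forall x, (fun m => dotnorm (iter m T x)) @ \oo --> (0 : R).

(* [S] is the Hilbert space adjoint of [T], which is unique because [dot] is
   definite. *)
Definition C00 (T : {linear V -> V}) : Prop :=
  [/\ contraction T, powers_sot_cvg0 T &
      exists S : {linear V -> V}, adjoint T S /\ powers_sot_cvg0 S].

End InnerProduct.

Lemma rsum_unit (R : realType) (f : unit -> R) : rsum f = f tt.
Proof.
have m0 x : (0 <= (Num.max x 0 : R)%:E)%E by rewrite lee_fin le_max lexx orbT.
rewrite /rsum (_ : setT = [set tt]); last by apply/seteqP; split=> -[].
by rewrite !esum_set1//=; case: (leP (f tt) 0) => h1; case: (leP (- f tt) 0) => h2; lra.
Qed.

Section Hardy.
Variable R : realType.

Definition H2D := l2 R nat.
Definition H2D2 := l2 R (nat * nat)%type.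

HB.instance Definition _ := GRing.Lmodule.on H2D.
HB.instance Definition _ := GRing.Lmodule.on H2D2.

Definition mulz_coef (f : nat -> R[i]) : nat -> R[i]^o :=
  fun n => if n is n'.+1 then f n' else 0.

Definition mulz1_coef (F : nat * nat -> R[i]) : nat * nat -> R[i]^o :=
  fun p => if p.1 is n'.+1 then F (n', p.2) else 0.

Definition fz2_coef (f : nat -> R[i]) : nat * nat -> R[i]^o :=
  fun p => if p.1 is _.+1 then 0 else f p.2.

Let inj_fz2 : injective (fun n : nat => (0%N, n)). Proof. by move=> x y []. Qed.
Let inj_z1 : injective (fun p : nat * nat => (p.1.+1, p.2)).
Proof. by move=> [x y] [x' y'] /= [-> ->]. Qed.

Let out_z (A : Type) (z : A) (g : nat -> A) : g 0%N = z ->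
  forall n, ~ range succn n -> g n = z.
Proof. by move=> g0 [|n]// []; exists n. Qed.

Let out_z1 (A : Type) (z : A) (g : nat * nat -> A) : (forall j, g (0%N, j) = z) ->
  forall p, ~ range (fun p : nat * nat => (p.1.+1, p.2)) p -> g p = z.
Proof. by move=> g0 [[|i] j]// []; exists (i, j). Qed.

Let out_fz2 (A : Type) (z : A) (g : nat * nat -> A) :
  (forall i j, g (i.+1, j) = z) ->
  forall p, ~ range (fun n : nat => (0%N, n)) p -> g p = z.
Proof. by move=> g0 [[|i] j]// []; exists j. Qed.

Let nsq0 : normc (0 : R[i]) ^+ 2 = 0.
Proof. by rewrite normc0 expr0n. Qed.

Lemma mulz_sqsummable (f : H2D) : mulz_coef f \in @sqsummable R nat.
Proof.
rewrite sqsummableE (rsummable_inj succn_inj) ?l2P//.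
by apply: out_z; exact: nsq0.
Qed.

Lemma mulz1_sqsummable (F : H2D2) : mulz1_coef F \in @sqsummable R (nat * nat)%type.
Proof.
rewrite sqsummableE (rsummable_inj inj_z1); last first.
  by apply: out_z1 => j; exact: nsq0.
by rewrite (_ : (fun i => _) = fun p => normc (F p) ^+ 2) ?l2P//;
  apply/funext => -[].
Qed.

Lemma fz2_sqsummable (f : H2D) : fz2_coef f \in @sqsummable R (nat * nat)%type.
Proof.
rewrite sqsummableE (rsummable_inj inj_fz2) ?l2P//.
by apply: out_fz2 => i j; exact: nsq0.
Qed.

Definition const_coef (c : R[i]) : nat -> R[i]^o :=
  fun n => if n is _.+1 then 0 else c.

Lemma const_sqsummable (c : R[i]) : const_coef c \in @sqsummable R nat.
Proof.
rewrite sqsummableE /rsummable (@esum_inj R unit nat (fun=> 0%N)) => [||[|n]].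
- by rewrite (_ : setT = [set tt]) ?esum_set1 ?ltry//; apply/seteqP; split=> -[].
- by move=> [] [].
- by case; exists tt.
- by move=> _; rewrite -[X in `|X|]/(normc (0 : R[i]) ^+ 2) nsq0 normr0.
Qed.

Definition constD (c : R[i]) : H2D := L2 (const_sqsummable c).

Definition mulz (f : H2D) : H2D := L2 (mulz_sqsummable f).
Definition mulz1 (F : H2D2) : H2D2 := L2 (mulz1_sqsummable F).
Definition fz2 (f : H2D) : H2D2 := L2 (fz2_sqsummable f).

Lemma mulz_is_linear : linear mulz.
Proof. by move=> c f g; apply: l2_eqP => -[|n]//; rewrite l2D l2Z /= mulr0 addr0. Qed.

Lemma mulz1_is_linear : linear mulz1.
Proof.
by move=> c F G; apply: l2_eqP => -[[|i] j]//; rewrite l2D l2Z /= mulr0 addr0.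
Qed.

Lemma fz2_is_linear : linear fz2.
Proof.
by move=> c F G; apply: l2_eqP => -[[|i] j]//; rewrite l2D l2Z /= mulr0 addr0.
Qed.

Lemma constD_is_linear : linear (constD : R[i]^o -> H2D).
Proof.
by move=> c a b; apply: l2_eqP => -[|n]//; rewrite l2D l2Z /= mulr0 addr0.
Qed.

(* The coefficient model agrees with multiplication and composition of
   holomorphic functions on the disk and the bidisk. *)
Definition evalD (f : H2D) (z : R[i]) : R[i] := csum (fun n => f n * z ^+ n).

Definition evalD2 (F : H2D2) (z1 z2 : R[i]) : R[i] :=
  csum (fun p => F p * (z1 ^+ p.1 * z2 ^+ p.2)).

Lemma evalD2_fz2 f z1 z2 : evalD2 (fz2 f) z1 z2 = evalD f z2.
Proof.
rewrite /evalD2 (csum_inj inj_fz2); last by apply: out_fz2 => i j; rewrite mul0r.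
by congr csum; apply/funext => n /=; rewrite mul1r.
Qed.

Lemma normcX (z : R[i]) n : normc (z ^+ n) = normc z ^+ n.
Proof. by elim: n => [|n ih]; rewrite ?normc1// !exprS normcM ih. Qed.

Lemma esum_geometric (x : R) : 0 <= x -> x < 1 ->
  (\esum_(n in [set: nat]) (x ^+ n)%:E = ((1 - x)^-1)%:E)%E.
Proof.
move=> x0 x1; rewrite -nneseries_esumT => [|n]; last by rewrite lee_fin exprn_ge0.
apply/cvg_lim => //.
under eq_fun do rewrite sumEFin.
apply/cvg_EFin; first exact: nearW.
have := @cvg_geometric_series R 1 x; rewrite ger0_norm// => /(_ x1).
rewrite mul1r; apply: cvg_trans; apply: near_eq_cvg; apply: nearW => n /=.
by rewrite /series/=; apply: eq_bigr => i _; rewrite mul1r.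
Qed.

Lemma normc_lt1 (z : R[i]) : `|z| < 1 -> normc z ^+ 2 < 1.
Proof.
move=> z1; have {}z1 : normc z < 1 by rewrite -(ltcR _ 1).
by rewrite expr_lt1// normc_ge0.
Qed.

Lemma expr_sqsummable (z : R[i]) : `|z| < 1 ->
  (fun n => z ^+ n : R[i]^o) \in @sqsummable R nat.
Proof.
move=> z1; rewrite unfold_in.
under eq_esum do rewrite normcX exprAC.
by rewrite esum_geometric ?sqr_ge0 ?normc_lt1// ltry.
Qed.

Let pow_ge0 (x : R) i : 0 <= (x ^+ 2) ^+ i.
Proof. by apply: exprn_ge0; exact: sqr_ge0. Qed.

Lemma expr2_sqsummable (z1 z2 : R[i]) : `|z1| < 1 -> `|z2| < 1 ->
  (fun p => z1 ^+ p.1 * z2 ^+ p.2 : R[i]^o) \in @sqsummable R (nat * nat)%type.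
Proof.
move=> h1 h2; rewrite unfold_in.
pose a i j := ((normc z1 ^+ 2) ^+ i * (normc z2 ^+ 2) ^+ j)%:E : \bar R.
rewrite (_ : esum _ _ = \esum_(p in [set: nat] `*`` (fun=> [set: nat])) a p.1 p.2)%E; last first.
  rewrite (_ : _ `*`` _ = setT); last by apply/seteqP; split.
  by apply: eq_esum => -[i j] _; rewrite normcM !normcX exprMn ![(_ ^+ _) ^+ 2]exprAC.
rewrite -esum_esum => [|i j _ _]; last first.
  by rewrite lee_fin; apply: mulr_ge0; exact: pow_ge0.
have e i : (\esum_(j in [set: nat]) a i j = ((1 - normc z2 ^+ 2)^-1 * (normc z1 ^+ 2) ^+ i)%:E)%E.
  rewrite /a (esumZ (pow_ge0 _ _)); last by move=> j; exact: pow_ge0.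
  by rewrite esum_geometric ?sqr_ge0 ?normc_lt1// -EFinM mulrC.
under eq_esum do rewrite e.
rewrite esumZ; last 2 first.
- by rewrite invr_ge0 subr_ge0 ltW// normc_lt1.
- by move=> i; exact: pow_ge0.
by rewrite esum_geometric ?sqr_ge0 ?normc_lt1// -EFinM ltry.
Qed.

Lemma evalD_constD c z : evalD (constD c) z = c.
Proof.
rewrite /evalD (@csum_inj R unit nat (fun=> 0%N)) => [||[|n]].
- by rewrite /csum !rsum_unit /= mulr1; case: c.
- by move=> [] [].
- by case; exists tt.
- by move=> _; rewrite mul0r.
Qed.

Lemma evalD_mulz f z : `|z| < 1 -> evalD (mulz f) z = z * evalD f z.
Proof.
move=> z1; rewrite /evalD (csum_inj succn_inj); last by apply: out_z; rewrite mul0r.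
rewrite -csumZ; last by apply: csummable_mul (expr_sqsummable z1); case: f.
by congr csum; apply/funext => n /=; rewrite exprS mulrCA.
Qed.

Lemma evalD2_mulz1 F z1 z2 : `|z1| < 1 -> `|z2| < 1 ->
  evalD2 (mulz1 F) z1 z2 = z1 * evalD2 F z1 z2.
Proof.
move=> h1 h2; rewrite /evalD2 (csum_inj inj_z1); last first.
  by apply: out_z1 => j; rewrite mul0r.
rewrite -csumZ; last by apply: csummable_mul (expr2_sqsummable h1 h2); case: F.
by congr csum; apply/funext => -[i j] /=; rewrite exprS -mulrA mulrCA.
Qed.

Definition brownian_space := (H2D2 * H2D * R[i]^o)%type.
HB.instance Definition _ := GRing.Lmodule.on brownian_space.

Definition brownian_dot (x y : brownian_space) : R[i]^o :=
  l2dot x.1.1 y.1.1 + l2dot x.1.2 y.1.2 + x.2 * Num.conj (y.2 : R[i]).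

Lemma brownian_dot_herm x y :
  brownian_dot x y = (-1) ^+ false * Num.conj (brownian_dot y x).
Proof.
rewrite /brownian_dot expr0 mul1r !rmorphD rmorphM /= conjCK.
by rewrite (l2dotC x.1.1) (l2dotC x.1.2) [x.2 * _]mulrC.
Qed.

Lemma brownian_dot_linl c x x' y :
  brownian_dot (c *: x + x') y = c * brownian_dot x y + brownian_dot x' y.
Proof.
rewrite /brownian_dot /= !l2dot_linl -[c *: x.2]/(c * x.2).
ring.
Qed.

Lemma brownian_dot_bilin :
  bilinear_for *%R (Num.conj \; *%R) brownian_dot.
Proof.
split=> [y|x] c u v; first exact: brownian_dot_linl.
rewrite brownian_dot_herm brownian_dot_linl expr0 mul1r rmorphD rmorphM.
by rewrite (brownian_dot_herm x u) (brownian_dot_herm x v) !expr0 !mul1r.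
Qed.

Lemma brownian_dot_gt0 x : x != 0 -> 0 < brownian_dot x x.
Proof.
case: x => [[F f] a] xn0; rewrite /brownian_dot /= -normCK.
have F0 := dnorm_ge0 (@l2dot R (nat * nat)%type) F.
have f0 := dnorm_ge0 (@l2dot R nat) f.
have a0 : 0 <= `|a| ^+ 2 by rewrite exprn_ge0.
rewrite lt_def !addr_ge0// andbT; apply: contra xn0.
rewrite !paddr_eq0 ?addr_ge0// dnorm_eq0 dnorm_eq0 sqrf_eq0 normr_eq0.
by move=> /andP[/andP[/eqP -> /eqP ->] /eqP ->].
Qed.

HB.instance Definition _ := bilinear_isBilinear.Build R[i]
  brownian_space brownian_space R[i]^o
  (GRing.Scale.Law.clone _ _ *%R _)
  (GRing.Scale.Law.clone _ _ (Num.conj \; *%R) _)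
  brownian_dot brownian_dot_bilin.
HB.instance Definition _ := isHermitianSesquilinear.Build R[i] brownian_space
  false Num.conj brownian_dot brownian_dot_herm.
HB.instance Definition _ := isDotProduct.Build R[i] brownian_space
  brownian_dot brownian_dot_gt0.

Definition brownian_shift3 (sigma theta : R) (x : brownian_space) : brownian_space :=
  let: (F, f, alpha) := x in
  (mulz1 F + sigma%:C *: fz2 f,
   mulz f + constD (sigma%:C * alpha),
   (cos theta +i* sin theta) * alpha).

Lemma brownian_shift3_is_linear sigma theta : linear (brownian_shift3 sigma theta).
Proof.
move=> c [[F f] a] [[G g] b]; congr ((_, _), _) => /=.
- rewrite mulz1_is_linear fz2_is_linear scalerDr scalerA mulrC -scalerA.
  by rewrite scalerDr addrACA.
- rewrite mulz_is_linear (_ : _ * (c *: a + b) =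
    c *: (sigma%:C * a) + sigma%:C * b); last by rewrite mulrDr mulrCA.
  by rewrite constD_is_linear scalerDr addrACA.
- by rewrite -[c *: a]/(c * a) mulrDr mulrCA.
Qed.

HB.instance Definition _ sigma theta :=
  GRing.isLinear.Build R[i] brownian_space brownian_space _
    (brownian_shift3 sigma theta) (brownian_shift3_is_linear sigma theta).

Definition normalized_shift3 (sigma theta : R) :
    {linear brownian_space -> brownian_space} :=
  ((Num.sqrt (1 + sigma ^+ 2))^-1)%:C \*: brownian_shift3 sigma theta.

End Hardy.

(* Main.v *)
From HB Require Import structures.
Require Import Defs.
From mathcomp Require Import all_boot all_order all_algebra.
From mathcomp Require Import sesquilinear complex.
From mathcomp Require Import all_classical all_reals all_analysis.
From mathcomp Require Import ring lra.

Set Implicit Arguments.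
Unset Strict Implicit.
Unset Printing Implicit Defensive.

Import Order.TTheory GRing.Theory Num.Theory.
Import numFieldNormedType.Exports.
Import Normc.

Local Open Scope ring_scope.

(** Write q = 1 / (1 + sigma^2) < 1.  The two summands in each of the first two
    components of the shift T (F, f, alpha) are orthogonal, and z_1, z, f |-> f_{z_2}
    and e^{i theta} are isometric.  So the squared norms (A, B, C) of the three
    components of a vector determine those of its image under the normalized
    shift ([normalized_shift3_sqnorms]):

      A' = q (A + sigma^2 B),   B' = q (B + sigma^2 C),   C' = q C.

    Since q sigma^2 = 1 - q, the sum of these is q A + B + C, which makes the
    normalized shift a contraction.  It need not be a strict one, as B + C may
    be preserved; but the linear map (A, B, C) |-> (A', B', C') is triangular
    with the single eigenvalue q, so its powers decay geometrically.  The
    weighted sum A + 2 B + 4 C makes this explicit: one step multiplies it by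
    at most (1 + q) / 2 ([normalized_shift3_energy]), and it is comparable to
    the squared norm ([sqnorm_energy]).

    The powers therefore tend to 0 in operator norm, not just strongly, and
    operator norms are invariant under taking adjoints; so the powers of the
    adjoint decay at the same rate ([adjoint_geometric_powers]), and the only
    thing to know about the adjoint is that it exists.  It is written down
    explicitly, from the fact that the adjoint of an embedding of coefficient
    families along an injection of index sets is the pullback along that
    injection ([l2dot_pullback]). *)

(** * Geometric decay of powers *)

Section GeometricDecay.
Variables (R : realType) (V : lmodType R[i]) (dot : {dot V for Num.conj}).

Definition sqnorm (x : V) : R := complex.Re (dot x x).

Lemma sqnorm_ge0 x : 0 <= sqnorm x.
Proof. by have := dnorm_ge0 dot x; rewrite lecE => /andP[]. Qed.

Lemma dot_self x : dot x x = (sqnorm x)%:C%C.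
Proof.
have := dnorm_ge0 dot x; rewrite lecE /sqnorm => /andP[/eqP /= h _].
by case: (dot x x) h => a b /= ->.
Qed.

(** The operator norm bound ||T^m||^2 <= K rho^m, spelled out pointwise. *)
Definition geometric_powers (K rho : R) (T : V -> V) : Prop :=
  forall m x, sqnorm (iter m T x) <= K * rho ^+ m * sqnorm x.

Lemma geometric_powers_cvg0 K rho T : 0 < rho -> rho < 1 ->
  geometric_powers K rho T -> powers_sot_cvg0 dot T.
Proof.
move=> rho0 rho1 decay x.
rewrite /dotnorm -(@sqrtr0 R).
apply: (@continuous_cvg _ _ _ _ _ (fun m => sqnorm (iter m T x))
  (@Num.sqrt R) 0); first exact: sqrt_continuous.
apply: (@squeeze_cvgr _ _ _ _ (fun=> 0) (geometric (K * sqnorm x) rho)).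
- apply: nearW => m; rewrite sqnorm_ge0 /=.
  by apply: le_trans (decay m x) _; rewrite mulrAC.
- exact: cvg_cst.
- by apply: cvg_geometric; rewrite gtr0_norm.
Qed.

(** Contracting a quadratic quantity comparable to the squared norm replaces
    contracting the norm itself, which a single step of the normalized shift
    does not do strictly. *)
Lemma lyapunov_geometric_powers K rho (T : V -> V) (E : V -> R) :
  0 < rho -> (forall x, sqnorm x <= E x <= K * sqnorm x) ->
  (forall x, E (T x) <= rho * E x) -> geometric_powers K rho T.
Proof.
move=> rho0 EK ET m x.
have [EKl _] := andP (EK (iter m T x)); apply: le_trans EKl _.
have decayE : E (iter m T x) <= rho ^+ m * E x.
  elim: m => [|m IHm]; first by rewrite expr0 mul1r.
  by apply: le_trans (ET _) _; rewrite exprS -mulrA ler_wpM2l// ltW.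
apply: le_trans decayE _; rewrite [K * _]mulrC -mulrA.
rewrite ler_wpM2l ?exprn_ge0 ?(ltW rho0)//.
by have /andP[] := EK x.
Qed.

Lemma adjoint_iter T S : adjoint dot T S ->
  forall m, adjoint dot (iter m T) (iter m S).
Proof.
by move=> adjTS; elim=> [|m IHm] x y //; rewrite iterS adjTS IHm -iterSr.
Qed.

(** The instance of the Cauchy-Schwarz inequality behind the equality of the
    norms of an operator and its adjoint: with [w] = S y and [u] = T w, the
    hypothesis [dot u y = dot w w] is adjointness.  Positivity of the squared
    norm of u - k y gives it directly. *)
Lemma sqnorm_le_dual (k : R) u w y : 0 < k ->
  dot u y = dot w w -> sqnorm u <= k * sqnorm w -> sqnorm w <= k * sqnorm y.
Proof.
move=> k0 uy uw; have := sqnorm_ge0 (u - k%:C%C *: y).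
have -> : sqnorm (u - k%:C%C *: y) =
    sqnorm u - 2 * k * sqnorm w + k ^+ 2 * sqnorm y.
  rewrite /sqnorm dnormB /= dnormZ linearZr_LR /= uy !dot_self.
  by rewrite normc_def /= expr0n addr0 sqrtr_sqr gtr0_norm//; ring.
by move=> h; rewrite -(ler_pM2l k0); lra.
Qed.

Lemma adjoint_geometric_powers K rho T S : 0 < K -> 0 < rho ->
  adjoint dot T S -> geometric_powers K rho T -> geometric_powers K rho S.
Proof.
move=> K0 rho0 adjTS decay m y.
apply: (@sqnorm_le_dual _ (iter m T (iter m S y))).
- by rewrite mulr_gt0 ?exprn_gt0.
- exact: adjoint_iter.
- exact: decay.
Qed.

End GeometricDecay.

Lemma sqnormZ_real (R : realType) (V : lmodType R[i])
    (dot : {dot V for Num.conj}) (a : R) (x : V) :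
  sqnorm dot (a%:C%C *: x) = a ^+ 2 * sqnorm dot x.
Proof.
rewrite /sqnorm dnormZ dot_self normc_def /= expr0n addr0 sqrtr_sqr.
rewrite -[X in _ = X * _]real_normK ?num_real//; ring.
Qed.

(** * Pulling coefficients back along an injection *)

Section Pullback.
Variables (R : realType) (I J : choiceType) (e : I -> J).
Hypothesis inj_e : injective e.

Lemma pullback_sqsummable (g : l2 R J) :
  (fun i => g (e i)) \in @sqsummable R I.
Proof.
have sg : coef g \in @sqsummable R J by case: g.
rewrite unfold_in; apply: le_lt_trans sg.
rewrite -(@esum_image _ _ _ setT e (fun j => (normc (g j) ^+ 2)%:E)); last first.
  by move=> x y _ _; exact: inj_e.
rewrite esum_mkcond; apply: le_esum => j _.
by case: ifP => // _; rewrite lee_fin sqr_ge0.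
Qed.

Definition pullback (g : l2 R J) : l2 R I := L2 (pullback_sqsummable g).

Lemma pullback_is_linear : linear pullback.
Proof. by move=> c f g; apply: l2_eqP. Qed.

(** Extension by zero along [e] sends [f] to the family [h] characterized here;
    [h] is left as a variable so that the lemma applies to the coefficient
    families of z f, z_1 F and f_{z_2} alike. *)
Lemma l2dot_pullback (f : l2 R I) (h g : l2 R J) :
  (forall i, h (e i) = f i) -> (forall j, ~ range e j -> h j = 0) ->
  l2dot h g = l2dot f (pullback g).
Proof.
move=> hf h0; rewrite /l2dot (csum_inj inj_e) => [|j /h0->]; last by rewrite mul0r.
by congr csum; apply/funext => i; rewrite hf.
Qed.

End Pullback.

(** * The adjoint of the 3-Brownian shift *)

Section BrownianAdjoint.
Variable R : realType.

Lemma inj_up1 : injective (fun p : nat * nat => (p.1.+1, p.2)).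
Proof. by move=> [a b] [c d] /= [-> ->]. Qed.

Lemma inj_axis2 : injective (fun n : nat => (0%N, n)).
Proof. by move=> a b []. Qed.

Definition mulz_adj : H2D R -> H2D R := pullback succn_inj.
Definition mulz1_adj : H2D2 R -> H2D2 R := pullback inj_up1.
Definition fz2_adj : H2D2 R -> H2D R := pullback inj_axis2.

Lemma l2dot_mulz f g : l2dot (mulz f) g = l2dot f (mulz_adj g).
Proof. by apply: l2dot_pullback => // -[|n] // []; exists n. Qed.

Lemma l2dot_mulz1 F G : l2dot (mulz1 F) G = l2dot F (mulz1_adj G).
Proof.
apply: l2dot_pullback => [[i j]|[[|i] j]] // []; by exists (i, j).
Qed.

Lemma l2dot_fz2 f G : l2dot (fz2 f) G = l2dot f (fz2_adj G).
Proof. by apply: l2dot_pullback => [//|[[|i] j]] // []; exists j. Qed.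

Lemma l2dot_constD (c : R[i]) g : l2dot (constD c) g = c * Num.conj (g 0%N : R[i]).
Proof.
rewrite /l2dot (@csum_inj R unit nat (fun=> 0%N)) => [||[|n]].
- by rewrite /csum !rsum_unit /=; case: (c * _).
- by move=> [] [].
- by case; exists tt.
- by move=> _; rewrite mul0r.
Qed.

Definition brownian_shift3_adj (sigma theta : R) (y : brownian_space R) :
    brownian_space R :=
  let: (G, g, beta) := y in
  (mulz1_adj G,
   sigma%:C%C *: fz2_adj G + mulz_adj g,
   sigma%:C%C * g 0%N + Num.conj (cos theta +i* sin theta)%C * beta).

Lemma brownian_shift3_adj_is_linear sigma theta :
  linear (brownian_shift3_adj sigma theta).
Proof.
move=> c [[F f] a] [[G g] b]; congr ((_, _), _) => /=.
- exact: pullback_is_linear.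
- rewrite /fz2_adj /mulz_adj !pullback_is_linear !scalerDr !scalerA mulrC.
  by rewrite addrACA.
- have lin (s e k u v p q : R[i]) :
      s * (k * u + v) + e * (k * p + q) = k * (s * u + e * p) + (s * v + e * q).
    by ring.
  exact: lin.
Qed.

HB.instance Definition _ sigma theta :=
  GRing.isLinear.Build R[i] (brownian_space R) (brownian_space R) _
    (brownian_shift3_adj sigma theta)
    (brownian_shift3_adj_is_linear sigma theta).

Definition normalized_shift3_adj (sigma theta : R) :
    {linear brownian_space R -> brownian_space R} :=
  ((Num.sqrt (1 + sigma ^+ 2))^-1)%:C%C \*: brownian_shift3_adj sigma theta.

Lemma conj_real (a : R) : Num.conj (a%:C%C : R[i]) = a%:C%C.
Proof. by rewrite /Num.conj /= oppr0. Qed.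

Lemma normalized_shift3_adjoint sigma theta :
  adjoint (@brownian_dot R) (normalized_shift3 sigma theta)
    (normalized_shift3_adj sigma theta).
Proof.
move=> [[F f] a] [[G g] b].
rewrite [LHS]linearZl_LR [RHS]linearZr_LR /= conj_real; congr (_ * _).
rewrite /brownian_dot /=.
rewrite !linearDl !linearZl_LR !linearDr !linearZr_LR /=.
rewrite l2dot_mulz1 l2dot_fz2 l2dot_mulz l2dot_constD.
have conj_comb (s : R) (u w z : R[i]) :
    Num.conj (s%:C%C * u + Num.conj w * z) = s%:C%C * Num.conj u + w * Num.conj z.
  by rewrite rmorphD !rmorphM /= conjCK conj_real.
rewrite conj_comb conj_real.
rewrite -[_ *: (a * _)]/(_ * (a * _)).
ring.
Qed.

End BrownianAdjoint.

(** * Energy decay under the normalized shift *)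

Lemma sqr_normc_real (R : realType) (a : R) : normc a%:C%C ^+ 2 = a ^+ 2.
Proof. by rewrite /= expr0n addr0 sqr_sqrtr ?sqr_ge0. Qed.

Lemma mul_conj_normc (R : realType) (c : R[i]) :
  c * Num.conj c = (normc c ^+ 2)%:C%C.
Proof. by rewrite -normCK rmorphXn. Qed.

Section Energy.
Variable R : realType.
Implicit Types (sigma theta : R) (x : brownian_space R).

Lemma brownian_sqnorm x : sqnorm (@brownian_dot R) x =
  sqnorm (@l2dot R _) x.1.1 + sqnorm (@l2dot R _) x.1.2 + normc x.2 ^+ 2.
Proof.
transitivity (complex.Re
    (l2dot x.1.1 x.1.1 + l2dot x.1.2 x.1.2 + (normc x.2 ^+ 2)%:C%C)).
  by rewrite -mul_conj_normc.
by rewrite !dot_self.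
Qed.

(** Orthogonality of the two summands is read off the adjoints: pulling the sum
    back along either embedding recovers the corresponding summand alone. *)
Lemma sqnorm_first sigma (F : H2D2 R) (f : H2D R) :
  sqnorm (@l2dot R _) (mulz1 F + sigma%:C%C *: fz2 f) =
  sqnorm (@l2dot R _) F + sigma ^+ 2 * sqnorm (@l2dot R _) f.
Proof.
set G := _ + _.
have GF : mulz1_adj G = F.
  have absorb (u c : R[i]) : u + c * 0 = u by rewrite mulr0 addr0.
  by apply: l2_eqP => -[i j]; exact: absorb.
have Gf : fz2_adj G = sigma%:C%C *: f by apply: l2_eqP => j; exact: add0r.
have GG : l2dot G G = (sqnorm (@l2dot R _) F +
    sigma ^+ 2 * sqnorm (@l2dot R _) f)%:C%C.
  rewrite {1}/G addrC l2dot_linl l2dot_mulz1 l2dot_fz2 GF Gf.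
  rewrite linearZr_LR /= conj_real !dot_self mulrA -!rmorphM -rmorphD.
  by rewrite addrC expr2.
by have := congr1 (@complex.Re R) GG; apply: etrans.
Qed.

Lemma sqnorm_second (f : H2D R) (c : R[i]) :
  sqnorm (@l2dot R _) (mulz f + constD c) =
  sqnorm (@l2dot R _) f + normc c ^+ 2.
Proof.
set g := _ + _.
have gf : mulz_adj g = f by apply: l2_eqP => n; exact: addr0.
have g0 : g 0%N = c by exact: add0r.
have gg : l2dot g g = (sqnorm (@l2dot R _) f + normc c ^+ 2)%:C%C.
  rewrite {1}/g -[mulz f]scale1r l2dot_linl mul1r l2dot_mulz l2dot_constD.
  rewrite gf g0 mul_conj_normc dot_self; exact: (esym (rmorphD _ _ _)).
by have := congr1 (@complex.Re R) gg; apply: etrans.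
Qed.

(** With weights 1, p, s, one step of the shift has coefficients q,
    q (sigma^2 + p) and q (p sigma^2 + s) on the three squared norms.  As
    q sigma^2 = 1 - q, requiring the last two to be p and s times the rate
    (1 + q) / 2 forces p = 2 and s = 4. *)
Definition energy x : R :=
  sqnorm (@l2dot R _) x.1.1 + 2 * sqnorm (@l2dot R _) x.1.2
  + 4 * normc x.2 ^+ 2.

Lemma sqnorm_energy x :
  sqnorm (@brownian_dot R) x <= energy x <= 4 * sqnorm (@brownian_dot R) x.
Proof.
rewrite brownian_sqnorm /energy.
have weights (a b c : R) : 0 <= a -> 0 <= b -> 0 <= c ->
    a + b + c <= a + 2 * b + 4 * c <= 4 * (a + b + c).
  by move=> *; apply/andP; split; lra.
by apply: weights; rewrite ?sqnorm_ge0 ?sqr_ge0.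
Qed.

Section OneStep.
Variables (sigma theta : R).

Definition damping : R := (1 + sigma ^+ 2)^-1.
Local Notation q := damping.

Lemma normc_cis : normc (cos theta +i* sin theta)%C = 1.
Proof. by rewrite /= cos2Dsin2 sqrtr1. Qed.

Lemma normalized_shift3_sqnorms x :
  let y := normalized_shift3 sigma theta x in
  [/\ sqnorm (@l2dot R _) y.1.1 = q *
        (sqnorm (@l2dot R _) x.1.1 + sigma ^+ 2 * sqnorm (@l2dot R _) x.1.2),
      sqnorm (@l2dot R _) y.1.2 = q *
        (sqnorm (@l2dot R _) x.1.2 + sigma ^+ 2 * normc x.2 ^+ 2) &
      normc y.2 ^+ 2 = q * normc x.2 ^+ 2].
Proof.
have r2 : (Num.sqrt (1 + sigma ^+ 2))^-1 ^+ 2 = q.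
  by rewrite exprVn sqr_sqrtr// addr_ge0 ?sqr_ge0.
case: x => [[F f] a]; split => /=.
- by rewrite sqnormZ_real r2 sqnorm_first.
- rewrite sqnormZ_real r2 sqnorm_second normcM exprMn.
  by rewrite sqr_normc_real.
- rewrite !normcM normc_cis mul1r exprMn.
  by rewrite sqr_normc_real r2.
Qed.

Lemma damping_sqr : q * sigma ^+ 2 = 1 - q.
Proof.
have d0 : 1 + sigma ^+ 2 != 0 by rewrite gt_eqF// ltr_pwDl// sqr_ge0.
by rewrite /damping; field.
Qed.

(** In terms of squared norms, each step is a convex combination. *)
Lemma damping_average u v : q * (u + sigma ^+ 2 * v) = q * u + (1 - q) * v.
Proof. by rewrite -damping_sqr; ring. Qed.

Lemma damping_le1 : q <= 1.
Proof. by rewrite -subr_ge0 -damping_sqr mulr_ge0 ?invr_ge0 ?addr_ge0 ?sqr_ge0. Qed.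

Lemma normalized_shift3_contraction :
  Defs.contraction (@brownian_dot R) (normalized_shift3 sigma theta).
Proof.
move=> x; apply: ler_wsqrtr.
have step (a b c : R) : 0 <= a ->
    q * (a + sigma ^+ 2 * b) + q * (b + sigma ^+ 2 * c) + q * c <= a + b + c.
  move=> a0; rewrite !damping_average.
  have : 0 <= (1 - q) * a by rewrite mulr_ge0 ?subr_ge0 ?damping_le1.
  lra.
have := step _ (sqnorm (@l2dot R _) x.1.2) (normc x.2 ^+ 2)
  (sqnorm_ge0 (@l2dot R _) x.1.1).
have [<- <- <-] := normalized_shift3_sqnorms x.
by rewrite -!brownian_sqnorm.
Qed.

Lemma normalized_shift3_energy x :
  energy (normalized_shift3 sigma theta x) <= (1 + q) / 2 * energy x.
Proof.
rewrite /energy; have [-> -> ->] := normalized_shift3_sqnorms x.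
have step (a b c : R) : 0 <= a ->
    q * (a + sigma ^+ 2 * b) + 2 * (q * (b + sigma ^+ 2 * c)) + 4 * (q * c) <=
    (1 + q) / 2 * (a + 2 * b + 4 * c).
  move=> a0; rewrite !damping_average.
  have : 0 <= (1 - q) * a by rewrite mulr_ge0 ?subr_ge0 ?damping_le1.
  lra.
exact/step/sqnorm_ge0.
Qed.

End OneStep.

End Energy.

Theorem theorem5p2 (R : realType) (sigma theta : R)
    (sigma_gt0 : 0 < sigma) (theta_ge0 : 0 <= theta) (theta_lt : theta < 2 * pi) :
  C00 (@brownian_dot R) (normalized_shift3 sigma theta).
Proof.
set q := damping sigma.
have s0 : 0 < sigma ^+ 2 by rewrite exprn_gt0.
have q0 : 0 < q by rewrite invr_gt0; lra.
have q1 : q < 1 by rewrite invf_lt1; lra.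
have rho0 : 0 < (1 + q) / 2 by lra.
have rho1 : (1 + q) / 2 < 1 by lra.
have decay := lyapunov_geometric_powers rho0 (@sqnorm_energy R)
  (@normalized_shift3_energy R sigma theta).
have adj := @normalized_shift3_adjoint R sigma theta.
split.
- exact: normalized_shift3_contraction.
- exact: geometric_powers_cvg0 rho0 rho1 decay.
- exists (normalized_shift3_adj sigma theta); split=> //.
  apply: (geometric_powers_cvg0 rho0 rho1).
  by apply: adjoint_geometric_powers adj decay.
Qed.
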